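(* For $\delta\in(0,1/2)$ let $\eta_\delta$ be the minimal $\eta>0$ such that \[\frac12\log\frac{1}{\delta^2+(1-\delta)^2}<\min\left\{\log\frac{1}{1-\delta},\ D(\eta\|\delta)\right\}.\] Let $\delta_{\max}\approx0.0974$ be the threshold such that $\eta_\delta<1/4$ for all $\delta<\delta_{\max}$. Then for any fixed $\delta\in(0,\delta_{\max})$ and $\rho=1-2\delta$, the fraction of functions $f:\{-1,1\}^n\to\{-1,1\}$ that are $\rho$-SP is at most $\exp\left(-2^{n[1-h(2\eta_\delta)]-o(n)}\right)$ as $n\to\infty$.
   Context: Logarithms are base 2. $h(t)=-t\log t-(1-t)\log(1-t)$ is the binary entropy and $D(p\|q)=p\log\frac pq+(1-p)\log\frac{1-p}{1-q}$ is the binary divergence. For $\rho\in[0,1]$, $T_\rho f(y^n)=\mathbb{E}[f(X^n)\mid Y^n=y^n]$ where $X^n$ is uniform on $\{-1,1\}^n$ and $Y^n$ is obtained by flipping each coordinate of $X^n$ independently with probability $(1-\rho)/2$. $\operatorname{sgn}(0)=0$. $f$ is $\rho$-SP if $f(y^n)=\operatorname{sgn}T_\rho f(y^n)$ for all $y^n$ with $T_\rho f(y^n)\neq0$.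
   Formalization: η_δ is taken as the infimum of the admissible η in (δ,1], not the minimal η>0: every small η>0 satisfies the inequality, since D(0‖δ)=log 1/(1-δ) exceeds the left side, so no minimum exists and δ_max≈0.0974 would fail. *)

(* Defs.v *)
From HB Require Import structures.
From mathcomp Require Import all_boot all_order all_algebra.
From mathcomp Require Import all_classical all_reals all_analysis.

Set Implicit Arguments.
Unset Strict Implicit.
Unset Printing Implicit Defensive.

Import Order.TTheory GRing.Theory Num.Theory.
Import numFieldNormedType.Exports.

Local Open Scope classical_set_scope.
Local Open Scope ring_scope.

Definition log2 (R : realType) (x : R) : R := ln x / ln 2.

(* In both formulas the convention 0 * log 0 = 0 is automatic, as ln 0 = 0. *)
Definition binary_entropy (R : realType) (t : R) : R :=
  - (t * log2 t) - (1 - t) * log2 (1 - t).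

Definition binary_divergence (R : realType) (p q : R) : R :=
  p * log2 (p / q) + (1 - p) * log2 ((1 - p) / (1 - q)).

Definition eta_condition (R : realType) (delta eta : R) : Prop :=
  2^-1 * log2 ((delta ^+ 2 + (1 - delta) ^+ 2)^-1) <
  Num.min (log2 ((1 - delta)^-1)) (binary_divergence eta delta).

(* The minimum ranges over eta > delta, the branch on which D(eta||delta) is
   the exponent of an upper tail.  Without this restriction every small eta > 0
   would be admissible, since D(0||delta) = log(1/(1-delta)) exceeds the
   left-hand side.  As the inequality is strict, the minimum is an infimum. *)
Definition eta_min (R : realType) (delta : R) : R :=
  inf [set eta : R | delta < eta <= 1 /\ eta_condition delta eta].

Definition delta_max (R : realType) : R :=
  sup [set d : R | 0 < d <= 2^-1 /\
         forall delta : R, 0 < delta < d -> eta_min delta < 4^-1].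

(* A bit b stands for the sign (-1)^b, so that {ffun 'I_n -> bool} is the
   cube {-1,1}^n and {ffun cube n -> bool} is the set of +-1-valued functions
   on it. *)
Definition cube (n : nat) : finType := {ffun 'I_n -> bool}.

Definition spin (R : realType) (b : bool) : R := (-1) ^+ b.

(* P(X^n = x, Y^n = y) *)
Definition joint_pmf (R : realType) (n : nat) (rho : R) (x y : cube n) : R :=
  #|cube n|%:R^-1 *
  \prod_(i < n) (if y i != x i then (1 - rho) / 2 else 1 - (1 - rho) / 2).

(* E[f(X^n) | Y^n = y] *)
Definition noise_op (R : realType) (n : nat) (rho : R)
    (f : {ffun cube n -> bool}) (y : cube n) : R :=
  (\sum_(x : cube n) spin R (f x) * joint_pmf rho x y) /
  (\sum_(x : cube n) joint_pmf rho x y).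

Definition self_predicting (R : realType) (n : nat) (rho : R)
    (f : {ffun cube n -> bool}) : bool :=
  [forall y : cube n, (noise_op rho f y != 0) ==>
     (spin R (f y) == Num.sg (noise_op rho f y))].

Definition sp_fraction (R : realType) (n : nat) (rho : R) : R :=
  #|[set f : {ffun cube n -> bool} | self_predicting rho f]%SET|%:R /
  #|{ffun cube n -> bool}|%:R.

(* Main.v *)
Require Import Defs.
From HB Require Import structures.
From mathcomp Require Import all_boot all_order all_algebra.
From mathcomp Require Import all_classical all_reals all_analysis.
From mathcomp Require Import ring lra.

(** Let t = 2^(-n D(eta||delta)) and u = (1 - delta)^n.  A Gilbert-Varshamov code
    of minimum distance > 2 eta n has at least 2^(n (1 - h(2 eta))) words, and the
    balls of radius eta n around them are disjoint, so that under a uniform f the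
    restrictions of f to these balls are independent.  Around a code word y,
    T_rho f(y) is the sum of u f(y), of the Rademacher sum S over the punctured
    ball, and of a remainder bounded by t (Chernoff).  The standard deviation of S
    is of order (delta^2 + (1 - delta)^2)^(n/2), which by the choice of eta exceeds
    both t and u exponentially; by anticoncentration, with probability at least
    1/10, S has sign opposite to f(y) and dominates the other two terms, in which
    case f is not self-predicting at y.  Independence gives the bound
    (9/10)^(2^(n (1 - h(2 eta)))) for each eta > eta_delta, and eta is then sent to
    eta_delta.

    After exponentiation, the condition at eta = 1/4 is the polynomial inequality
    256 delta (1 - delta)^3 < 27 (delta^2 + (1 - delta)^2)^2, which locates
    delta_max. *)

Set Implicit Arguments.
Unset Strict Implicit.
Unset Printing Implicit Defensive.

Import Order.TTheory GRing.Theory Num.Theory.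
Import numFieldNormedType.Exports.

Local Open Scope classical_set_scope.
Local Open Scope ring_scope.

(** * Independence of events supported on disjoint sets of arguments *)

Definition depends_only_on (T : finType) (A : {set T})
    (P : pred {ffun T -> bool}) :=
  forall f g : {ffun T -> bool}, {in A, f =1 g} -> P f = P g.

Definition splice (T : finType) (A : {set T}) (f g : {ffun T -> bool}) :
    {ffun T -> bool} :=
  [ffun x => if x \in A then f x else g x].

(** Counting form of independence: exchanging the parts of [f] and [g] outside [A] is an involution
    on pairs, under which the condition [P f && Q f] becomes [P f && Q g]. *)
Lemma card_depends_indep (T : finType) (A : {set T})
    (P Q : pred {ffun T -> bool}) :
  depends_only_on A P -> depends_only_on (~: A)%SET Q ->
  (#|[set f | P f && Q f]%SET| * #|{ffun T -> bool}| =
   #|[set f | P f]%SET| * #|[set f | Q f]%SET|)%N.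
Proof.
move=> PA QA.
pose swap (u : {ffun T -> bool} * {ffun T -> bool}) :=
  (splice A u.1 u.2, splice A u.2 u.1).
have swapK : involutive swap.
  move=> [f g]; rewrite /swap /=; congr (_, _); apply/ffunP => x;
  by rewrite !ffunE; case: (x \in A).
rewrite -cardsT -!cardsX -(card_preimset _ (inv_inj swapK)).
congr #|pred_of_set _|; apply/setP => -[f g]; rewrite !inE /= andbT.
congr (_ && _); first by apply: PA => x xA; rewrite ffunE xA.
by apply: QA => x; rewrite inE ffunE => /negbTE ->.
Qed.

(** By induction on [s]: by disjointness the events of the tail depend only on arguments outside
    [A i], so each index contributes a factor of at most [1 - c]. *)
Lemma card_avoid_indep (R : realFieldType) (T I : finType) (A : I -> {set T})
    (E : I -> pred {ffun T -> bool}) (c : R) (s : seq I) :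
  uniq s ->
  {in s &, forall i j, i != j -> forall x, x \in A i -> x \notin A j} ->
  (forall i, depends_only_on (A i) (E i)) ->
  c <= 1 ->
  {in s, forall i, c * #|{ffun T -> bool}|%:R <= #|[set f | E i f]%SET|%:R} ->
  #|[set f | all (fun i => ~~ E i f) s]%SET|%:R
    <= (1 - c) ^+ size s * #|{ffun T -> bool}|%:R.
Proof.
move=> + + EA c1; elim: s => [_ _ _|i s IHs /= /andP[i_s us] disj cE].
  by rewrite expr0 mul1r ler_nat max_card.
have N0 : 0 < #|{ffun T -> bool}|%:R :> R.
  by rewrite ltr0n; apply/card_gt0P; exists [ffun=> true].
rewrite -(ler_pM2r N0) -natrM (card_depends_indep (A := A i)); first last.
- move=> f g fg; apply: eq_in_all => j js; congr (~~ _); apply: EA => x xj.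
  apply: fg; rewrite inE; apply/negP => xi.
  have ij : i != j by apply: contraNneq i_s => ->.
  by move: xj; apply/negP/(disj i) => //; rewrite inE ?eqxx ?js ?orbT.
- by move=> f g fg; congr (~~ _); apply: EA fg.
rewrite natrM (_ : _ * _ * _ = ((1 - c) * #|{ffun T -> bool}|%:R)
  * ((1 - c) ^+ size s * #|{ffun T -> bool}|%:R)); last by rewrite exprS; ring.
apply: ler_pM => //.
- have := cE i (mem_head _ _).
  have -> : [set f | ~~ E i f]%SET = (~: [set f | E i f])%SET.
    by apply/setP => f; rewrite !inE.
  have := cardsC [set f | E i f]%SET.
  by move=> /(congr1 (fun k => k%:R : R)); rewrite natrD; lra.
- apply: IHs => // [j k js ks|j js].
    by apply: disj; rewrite inE ?js ?ks orbT.
  by apply: cE; rewrite inE js orbT.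
Qed.

(** * Moments and anticoncentration of Rademacher sums *)

Definition flip (T : finType) (x : T) (f : {ffun T -> bool}) :
    {ffun T -> bool} := [ffun z => f z (+) (z == x)].

Lemma flipK (T : finType) (x : T) : involutive (flip x).
Proof. by move=> f; apply/ffunP => z; rewrite !ffunE -addbA addbb addbF. Qed.

Lemma spin_sqr (R : realType) (b : bool) : spin R b ^+ 2 = 1.
Proof. by case: b; rewrite /spin ?expr0 ?expr1 ?sqrrN expr1n. Qed.

Lemma spin_flip (R : realType) (T : finType) (x z : T) (f : {ffun T -> bool}) :
  spin R (flip x f z) = if z == x then - spin R (f z) else spin R (f z).
Proof.
by rewrite /spin ffunE; case: (z == x); case: (f z); rewrite /= ?expr0 ?expr1 ?opprK.
Qed.

Definition signed_sum (R : realType) (T : finType) (a : T -> R) (s : seq T)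
    (f : {ffun T -> bool}) : R :=
  \sum_(x <- s) a x * spin R (f x).

Lemma signed_sum_flip (R : realType) (T : finType) (a : T -> R) (s : seq T)
    (x : T) (f : {ffun T -> bool}) :
  x \notin s -> signed_sum a s (flip x f) = signed_sum a s f.
Proof.
move=> xs; apply: eq_big_seq => z zs; rewrite spin_flip.
by case: eqP => // zx; move: xs; rewrite -zx zs.
Qed.

(** Flipping the sign at [x] negates every summand. This removes the odd cross terms from the
    moments below. *)
Lemma sum_flip_odd (R : realType) (T : finType) (x : T)
    (G : {ffun T -> bool} -> R) :
  (forall f, G (flip x f) = G f) -> \sum_f G f * spin R (f x) = 0.
Proof.
move=> Gx; set s := LHS.
suff : s = - s by move=> ?; lra.
rewrite {1}/s (reindex_inj (inv_inj (flipK x))) /= -sumrN.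
by apply: eq_bigr => f _; rewrite Gx spin_flip eqxx mulrN.
Qed.

Lemma signed_sum_moment2 (R : realType) (T : finType) (a : T -> R) (s : seq T) :
  uniq s ->
  \sum_f signed_sum a s f ^+ 2 =
  #|{ffun T -> bool}|%:R * \sum_(x <- s) a x ^+ 2.
Proof.
elim: s => [_|x s IHs /= /andP[xs us]].
  by rewrite big_nil mulr0 big1// => f _; rewrite /signed_sum big_nil expr0n.
under eq_bigr => f _.
  rewrite /signed_sum big_cons -/(signed_sum a s f).
  rewrite (_ : _ ^+ 2 = signed_sum a s f ^+ 2 + a x ^+ 2 * spin R (f x) ^+ 2
     + (2 * a x * signed_sum a s f) * spin R (f x)); last by ring.
  rewrite spin_sqr mulr1.
  over.
rewrite big_split /= (sum_flip_odd (G := fun f => 2 * a x * signed_sum a s f)).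
  rewrite addr0 big_split /= IHs// sumr_const big_cons.
  by rewrite -[a x ^+ 2 *+ _]mulr_natl -mulrDr addrC.
by move=> f; rewrite signed_sum_flip.
Qed.

Lemma signed_sum_moment4 (R : realType) (T : finType) (a : T -> R) (s : seq T) :
  uniq s ->
  \sum_f signed_sum a s f ^+ 4 <=
  #|{ffun T -> bool}|%:R * (3 * (\sum_(x <- s) a x ^+ 2) ^+ 2).
Proof.
elim: s => [_|x s IHs /= /andP[xs us]].
  rewrite big_nil expr0n /= !mulr0 big1// => f _.
  by rewrite /signed_sum big_nil expr0n.
under eq_bigr => f _.
  rewrite /signed_sum big_cons -/(signed_sum a s f).
  (* The expansion is grouped by parity in [spin R (f x)]; the last group is odd and sums to
     zero. *)
  rewrite (_ : _ ^+ 4 = signed_sum a s f ^+ 4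
     + 6 * a x ^+ 2 * signed_sum a s f ^+ 2 * spin R (f x) ^+ 2
     + a x ^+ 4 * (spin R (f x) ^+ 2) ^+ 2
     + (4 * a x * signed_sum a s f ^+ 3
        + 4 * a x ^+ 3 * signed_sum a s f * spin R (f x) ^+ 2)
       * spin R (f x)); last by ring.
  rewrite spin_sqr expr1n !mulr1.
  over.
rewrite big_split /= (sum_flip_odd (G := fun f => 4 * a x * signed_sum a s f ^+ 3
        + 4 * a x ^+ 3 * signed_sum a s f)); last first.
  by move=> f; rewrite signed_sum_flip.
rewrite addr0 !big_split /= -mulr_sumr signed_sum_moment2// sumr_const big_cons.
rewrite -[a x ^+ 4 *+ _]mulr_natl; have := IHs us.
set v := \sum_(j <- s) _; set N := #|_|%:R => IH.
apply: (@le_trans _ _ (N * (3 * v ^+ 2) + 6 * a x ^+ 2 * (N * v) + N * a x ^+ 4)).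
  by rewrite !lerD2r.
(* With a = [a x], the slack is 3 (v + a^2)^2 - (3 v^2 + 6 a^2 v + a^4) = 2 a^4. *)
rewrite -subr_ge0 (_ : _ - _ = 2 * (N * (a x ^+ 2) ^+ 2)); last by ring.
by rewrite mulr_ge0// mulr_ge0 ?ler0n ?exprn_even_ge0.
Qed.

(* Second-moment method: [(z - 1/4)(8 - z)/16] is at most the indicator of
   [z >= 1/4], and its mean at [z = S^2 / V] is bounded below since
   [E z = 1] and [E z^2 <= 3]. *)
Lemma signed_sum_anticoncentration (R : realType) (T : finType) (a : T -> R)
    (s : seq T) (theta : R) :
  uniq s -> 4 * theta ^+ 2 <= \sum_(x <- s) a x ^+ 2 ->
  0 < \sum_(x <- s) a x ^+ 2 ->
  5^-1 * #|{ffun T -> bool}|%:R <=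
  #|[set f | theta ^+ 2 <= signed_sum a s f ^+ 2]%SET|%:R :> R.
Proof.
move=> us; have := signed_sum_moment4 a us; have := signed_sum_moment2 a us.
set V := \sum_(x <- s) _; set N := #|{ffun _ -> _}|%:R => m2 m4 thV V0.
move: V m2 m4 thV V0 => V m2 m4 thV V0.
rewrite -sum1_card natr_sum big_mkcond /=.
have N0 : 0 <= N by rewrite ler0n.
have mean : V ^+ 2 * (5^-1 * N) <=
   \sum_f ((signed_sum a s f ^+ 2 - V / 4) * (8 * V - signed_sum a s f ^+ 2) / 16).
  under eq_bigr => f _.
    rewrite (_ : _ / 16 = (33 / 64 * V) * signed_sum a s f ^+ 2
      + (- (1 / 16)) * signed_sum a s f ^+ 4 + (- (V ^+ 2 / 8))); last by field.
    over.
  rewrite !big_split /= -!mulr_sumr sumr_const m2 -[_ *+ #|_|]mulr_natr -/N.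
  (* The mean is at least (33/64 - 3/16 - 1/8) V^2 = 13/64 V^2, just above V^2 / 5. *)
  have : 0 <= N * V ^+ 2 by rewrite mulr_ge0// sqr_ge0.
  move: m4; set M := \sum_f _; nra.
rewrite -(ler_pM2l (exprn_gt0 2 V0)) (le_trans mean)// mulr_sumr.
apply: ler_sum => f _; rewrite inE; set z := signed_sum a s f ^+ 2.
have z0 : 0 <= z by rewrite sqr_ge0.
case: ifPn => [_|].
  (* The parabola peaks at the midpoint 33/8 V of its roots, with value (31/8)^2 V^2 < 16 V^2. *)
  by have := sqr_ge0 (z - 33 / 8 * V); have := sqr_ge0 V; nra.
rewrite -ltNge => zt; rewrite mulr0.
have zV : 0 < V / 4 - z by lra.
have zV8 : 0 < 8 * V - z by lra.
by have := mulr_gt0 zV zV8; nra.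
Qed.

(** Flipping [f y] leaves the sum unchanged and reverses its sign relative to [f y]. The event of a
    large sum is thus the union of two equinumerous events, whence half of 1/5. *)
Lemma signed_sum_opposes (R : realType) (T : finType) (a : T -> R)
    (s : seq T) (y : T) (theta : R) :
  uniq s -> y \notin s -> 0 < theta -> 4 * theta ^+ 2 <= \sum_(x <- s) a x ^+ 2 ->
  10^-1 * #|{ffun T -> bool}|%:R <=
  #|[set f : {ffun T -> bool} |
      spin R (f y) * signed_sum a s f <= - theta]%SET|%:R :> R.
Proof.
move=> us ys th0 thV.
have V0 : 0 < \sum_(x <- s) a x ^+ 2 by apply: lt_le_trans thV; nra.
have := signed_sum_anticoncentration us thV V0.
set A := [set f | _ <= - _]%SET.
have -> : [set f | theta ^+ 2 <= signed_sum a s f ^+ 2]%SET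
    = (A :|: flip y @^-1: A)%SET.
  apply/setP => f; rewrite !inE signed_sum_flip// spin_flip eqxx.
  have -> : signed_sum a s f ^+ 2 = (spin R (f y) * signed_sum a s f) ^+ 2.
    by rewrite exprMn spin_sqr mul1r.
  set u := _ * _; rewrite mulNr -/u.
  apply/idP/orP => [tu|[ut|ut]]; [|by nra|by nra].
  have [u0|u0] := lerP u 0; [left|right]; first by nra.
  by nra.
have := leq_card_setU A (flip y @^-1: A)%SET.
rewrite (card_preimset _ (inv_inj (flipK y))) => /= cU.
move: (cU : (_ <= _)%N); rewrite -(ler_nat R) natrD /=; lra.
Qed.

(** * Hamming distance, noise weights, Chernoff bounds and codes *)

Definition hdist (n : nat) (x y : cube n) : nat :=
  #|[set i | y i != x i]%SET|.

(** The conditional probability of X^n = x given Y^n = y at crossover probability [q]. *)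
Definition noise_weight (R : realType) (n : nat) (q : R) (x y : cube n) : R :=
  \prod_(i < n) (if y i != x i then q else 1 - q).

(** Divergence in nats, with logarithms of quotients split so that identities between divergences
    are ring identities. *)
Definition nat_divergence (R : realType) (p q : R) : R :=
  p * (ln p - ln q) + (1 - p) * (ln (1 - p) - ln (1 - q)).

Lemma hdistxx (n : nat) (x : cube n) : hdist x x = 0%N.
Proof. by apply/eqP; rewrite cards_eq0; apply/eqP/setP => i; rewrite !inE eqxx. Qed.

Lemma hdistC (n : nat) (x y : cube n) : hdist x y = hdist y x.
Proof.
by rewrite /hdist; congr #|pred_of_set _|; apply/setP => i; rewrite !inE eq_sym.
Qed.

Lemma hdist_triangle (n : nat) (z x y : cube n) :
  (hdist x y <= hdist x z + hdist z y)%N.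
Proof.
rewrite /hdist.
apply: leq_trans (leq_card_setU [set i | z i != x i]%SET [set i | y i != z i]%SET).
apply/subset_leq_card/fintype.subsetP => i; rewrite !inE.
by case: (y i) (z i) (x i) => [] [] [].
Qed.

Lemma leq_hdist (n : nat) (x y : cube n) : (hdist x y <= n)%N.
Proof. by rewrite -[leqRHS]card_ord max_card. Qed.

Lemma sum_prod_cube (R : comRingType) (n : nat) (a b : R) (y : cube n) :
  \sum_(x : cube n) \prod_(i < n) (if y i != x i then a else b) = (a + b) ^+ n.
Proof.
rewrite -(bigA_distr_bigA (fun i j => if y i != j then a else b)) /=.
under eq_bigr => i _.
  rewrite (_ : \sum_j _ = a + b).
    over.
  by rewrite big_bool /=; case: (y i); rewrite //= addrC.
by rewrite prodr_const card_ord.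
Qed.

Lemma prod_cube_hdist (R : comRingType) (n : nat) (a b : R) (x y : cube n) :
  \prod_(i < n) (if y i != x i then a else b) =
  a ^+ hdist x y * b ^+ (n - hdist x y).
Proof.
rewrite (bigID (fun i => y i != x i)) /=; congr (_ * _).
  rewrite (eq_bigr (fun=> a)); last by move=> i ->.
  by rewrite prodr_const /hdist cardsE.
rewrite (eq_bigr (fun=> b)); last by move=> i /negbTE ->.
rewrite prodr_const; congr (_ ^+ _).
apply/eqP; rewrite -(eqn_add2l (hdist x y)) subnKC ?leq_hdist//.
rewrite -[X in _ == X]card_ord -(cardsC [set i | y i != x i]%SET).
by rewrite eqn_add2l; apply/eqP/eq_card => i; rewrite !inE unfold_in.
Qed.

Lemma sum_noise_weight (R : realType) (n : nat) (q : R) (y : cube n) :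
  \sum_(x : cube n) noise_weight q x y = 1.
Proof. by rewrite sum_prod_cube addrC subrK expr1n. Qed.

Lemma sum_noise_weight_sqr (R : realType) (n : nat) (q : R) (y : cube n) :
  \sum_(x : cube n) noise_weight q x y ^+ 2 = (q ^+ 2 + (1 - q) ^+ 2) ^+ n.
Proof.
rewrite -(sum_prod_cube _ _ y); apply: eq_bigr => x _.
by rewrite /noise_weight -prodrXl; apply: eq_bigr => i _; case: ifP.
Qed.

Lemma noise_weight_ge0 (R : realType) (n : nat) (q : R) (x y : cube n) :
  0 <= q <= 1 -> 0 <= noise_weight q x y.
Proof.
by move=> /andP[q0 q1]; apply: prodr_ge0 => i _; case: ifP => // _; rewrite subr_ge0.
Qed.

Lemma noise_weightxx (R : realType) (n : nat) (q : R) (x : cube n) :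
  noise_weight q x x = (1 - q) ^+ n.
Proof. by rewrite /noise_weight prod_cube_hdist hdistxx expr0 mul1r subn0. Qed.

Lemma noise_weightE (R : realType) (n : nat) (q : R) (x y : cube n) :
  0 < q < 1 ->
  noise_weight q x y =
  expR ((hdist x y)%:R * ln q + (n%:R - (hdist x y)%:R) * ln (1 - q)).
Proof.
move=> /andP[q0 q1]; rewrite /noise_weight prod_cube_hdist expRD.
by rewrite -natrB ?leq_hdist// !expRM_natl !lnK// posrE ?subr_gt0.
Qed.

(* Chernoff bound by change of measure: on [A] the weight with parameter [q] is
   at most [expR (- n * D(p || q))] times the weight with parameter [p]. *)
Lemma chernoff_cube (R : realType) (n : nat) (p q : R) (y : cube n)
    (A : pred (cube n)) :
  0 < p < 1 -> 0 < q < 1 ->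
  (forall x, A x -> ((hdist x y)%:R - n%:R * p)
                    * (ln q - ln p - (ln (1 - q) - ln (1 - p))) <= 0) ->
  \sum_(x | A x) noise_weight q x y <= expR (- (n%:R * nat_divergence p q)).
Proof.
move=> p01 q01 hA; set e := expR _.
have e0 : 0 <= e by exact: expR_ge0.
rewrite -[leRHS]mulr1 -(sum_noise_weight p y) mulr_sumr.
rewrite big_mkcond /=; apply: ler_sum => x _; case: ifPn => [Ax|_].
  rewrite !noise_weightE// -expRD ler_expR -subr_le0.
  (* The difference of the two exponents is exactly the expression bounded in [hA]. *)
  apply: le_trans (hA _ Ax); rewrite le_eqVlt; apply/orP; left; apply/eqP.
  by rewrite /nat_divergence; ring.
apply: mulr_ge0 => //; apply: noise_weight_ge0.
by case/andP: p01 => ? ?; rewrite !ltW.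
Qed.

Lemma ler_ln_pos (R : realType) (x y : R) : 0 < x -> x <= y -> ln x <= ln y.
Proof. by move=> x0 xy; rewrite ler_ln// posrE (lt_le_trans x0 xy). Qed.

Lemma noise_upper_tail (R : realType) (n : nat) (p q : R) (y : cube n) (r : nat) :
  0 < q -> q < p -> p < 1 -> n%:R * p <= r.+1%:R ->
  \sum_(x | (r < hdist x y)%N) noise_weight q x y
    <= expR (- (n%:R * nat_divergence p q)).
Proof.
move=> q0 qp p1 npr; apply: chernoff_cube; [lra|lra|move=> x rx].
have l1 : ln q <= ln p by apply: ler_ln_pos; lra.
have l2 : ln (1 - p) <= ln (1 - q) by apply: ler_ln_pos; lra.
(* The strict inequality [r < hdist x y] gains one, which lets [r] be the floor of n p. *)
have : r.+1%:R <= (hdist x y)%:R :> R by rewrite ler_nat.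
by move=> h; apply: mulr_ge0_le0; lra.
Qed.

(** At [q = 1/2] every point has weight 2^(-n), so the lower-tail Chernoff bound counts points: the
    ball has at most 2^(n h(p)) of them. *)
Lemma card_hamming_ball_le (R : realType) (n : nat) (p : R) (y : cube n) (r : nat) :
  0 < p -> p < 2^-1 -> r%:R <= n%:R * p ->
  #|[set x : cube n | (hdist x y <= r)%N]%SET|%:R
    * expR (n%:R * nat_divergence p 2^-1) <= #|cube n|%:R :> R.
Proof.
move=> p0 p2 npr.
have c2 : #|cube n|%:R = 2 ^+ n :> R.
  by rewrite card_ffun card_bool card_ord natrX.
have : \sum_(x | (hdist x y <= r)%N) noise_weight 2^-1 x y
    <= expR (- (n%:R * nat_divergence p 2^-1)).
  apply: chernoff_cube; [lra|lra|move=> x xr].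
  have l1 : ln p <= ln 2^-1 by apply: ler_ln_pos; lra.
  have l2 : ln (1 - 2^-1) <= ln (1 - p) by apply: ler_ln_pos; lra.
  have h : (hdist x y)%:R <= r%:R :> R by rewrite ler_nat.
  by apply: mulr_le0_ge0; lra.
have -> : \sum_(x | (hdist x y <= r)%N) noise_weight 2^-1 x y
    = #|[set x : cube n | (hdist x y <= r)%N]%SET|%:R * (2^-1) ^+ n :> R.
  rewrite (eq_bigr (fun=> 2^-1 ^+ n)) => [|x _].
    by rewrite sumr_const cardsE mulr_natl.
  rewrite /noise_weight (eq_bigr (fun=> 2^-1)) ?prodr_const ?card_ord// => i _.
  by case: ifP => // _; lra.
rewrite c2 expRN exprVn ler_pdivrMr ?exprn_gt0// mulrC.
by rewrite ler_pdivlMr ?expR_gt0.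
Qed.

(** In a maximal code every word lies within [r] of a code word, since otherwise it could be added.
    The balls of radius [r] around the code words therefore cover the cube. *)
Lemma gilbert_varshamov (R : realType) (n : nat) (p : R) (r : nat) :
  0 < p -> p < 2^-1 -> r%:R <= n%:R * p ->
  exists C : {set cube n},
    {in C &, forall x y, x != y -> (r < hdist x y)%N} /\
    expR (n%:R * nat_divergence p 2^-1) <= #|C|%:R :> R.
Proof.
move=> p0 p2 npr.
pose code (C : {set cube n}) :=
  [forall x in C, forall y in C, (x != y) ==> (r < hdist x y)%N].
have codeP (C : {set cube n}) : reflect {in C &, forall x y, x != y -> (r < hdist x y)%N} (code C).
  apply: (iffP idP) => [/forall_inP cC x y xC yC xy|cC].
    by have /forall_inP/(_ y yC)/implyP := cC x xC; apply.
  by apply/forall_inP => x xC; apply/forall_inP => y yC; apply/implyP; apply: cC.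
have [|C /maxsetP[/codeP cC Cmax]] := @ex_maxset _ code.
  by exists finset.set0; apply/codeP => x y; rewrite inE.
exists C; split=> //.
pose B y := [set x : cube n | (hdist x y <= r)%N]%SET.
have cover x : exists2 y, y \in C & x \in B y.
  have [xC|xC] := boolP (x \in C); first by exists x; rewrite // inE hdistxx.
  apply/exists_inP; apply: contraT; rewrite negb_exists_in => /forall_inP far.
  have : (x |: C)%SET = C.
    apply: Cmax; last exact: finset.subsetUr.
    apply/codeP => u v; rewrite !inE => /orP[/eqP->|uC] /orP[/eqP->|vC].
    - by rewrite eqxx.
    - by move=> _; have := far v vC; rewrite inE -ltnNge.
    - by move=> _; have := far u uC; rewrite inE -ltnNge hdistC.
    - exact: cC.
  by move=> /setP/(_ x); rewrite !inE eqxx (negbTE xC).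
set e := expR _; have e0 : 0 < e by exact: expR_gt0.
have N0 : 0 < #|cube n|%:R :> R.
  by rewrite ltr0n; apply/card_gt0P; exists [ffun=> true].
have : #|cube n|%:R <= \sum_(y in C) #|B y|%:R :> R.
  rewrite -natr_sum ler_nat.
  under eq_bigr do rewrite -sum1_card big_mkcond.
  rewrite exchange_big -sum1_card leq_sum// => x _.
  by have [y yC xB] := cover x; rewrite (bigD1 y) //= xB.
move=> h; rewrite -(ler_pM2r N0) mulrC.
apply: (@le_trans _ _ (\sum_(y in C) (#|B y|%:R * e))).
  by rewrite -mulr_suml ler_pM2r.
rewrite mulr_natl -sumr_const; apply: ler_sum => y _.
exact: card_hamming_ball_le.
Qed.

(** * Self-prediction and the bound at fixed block length *)

Lemma noise_opE (R : realType) (n : nat) (q : R) (f : {ffun cube n -> bool})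
    (y : cube n) :
  noise_op (1 - 2 * q) f y = \sum_(x : cube n) spin R (f x) * noise_weight q x y.
Proof.
have N0 : #|cube n|%:R != 0 :> R.
  by rewrite pnatr_eq0 -lt0n; apply/card_gt0P; exists [ffun=> true].
have jE (x : cube n) : joint_pmf (1 - 2 * q) x y = #|cube n|%:R^-1 * noise_weight q x y.
  congr (_ * _); apply: eq_bigr => i _.
  by rewrite (_ : (1 - (1 - 2 * q)) / 2 = q)//; field.
rewrite /noise_op (eq_bigr _ (fun x _ => jE x)) -mulr_sumr sum_noise_weight mulr1.
rewrite (eq_bigr (fun x => #|cube n|%:R^-1 * (spin R (f x) * noise_weight q x y))).
  by rewrite -mulr_sumr mulrAC mulfV ?mul1r// invr_eq0.
by move=> x _; rewrite jE mulrCA.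
Qed.

(** The inequality is weak because self-prediction asserts nothing where the noise operator
    vanishes; refuting it takes a strictly negative product. *)
Lemma self_predicting_agree (R : realType) (n : nat) (q : R)
    (f : {ffun cube n -> bool}) (y : cube n) :
  self_predicting (1 - 2 * q) f ->
  0 <= spin R (f y) * \sum_(x : cube n) spin R (f x) * noise_weight q x y.
Proof.
move=> /forallP/(_ y); rewrite noise_opE; set s := \sum_x _.
have [->|s0] := eqVneq s 0; first by rewrite mulr0.
by move=> /eqP ->; rewrite -normrEsg normr_ge0.
Qed.

Definition punctured_ball (n : nat) (y : cube n) (r : nat) : {set cube n} :=
  [set x : cube n | (hdist x y <= r)%N & x != y]%SET.

Section finite_bound.
Variables (R : realType) (n r : nat) (delta eta : R).
Hypotheses (delta0 : 0 < delta) (delta_eta : delta < eta) (eta4 : eta < 4^-1).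
Hypotheses (r_lb : n%:R * eta <= r.+1%:R) (r_ub : r%:R <= n%:R * eta).

Let t := expR (- (n%:R * nat_divergence eta delta)).
Let u : R := (1 - delta) ^+ n.
Let w (y x : cube n) : R := noise_weight delta x y.

Let delta1 : 0 < 1 - delta.
Proof. by move: delta_eta eta4; lra. Qed.

Let w0 y x : 0 <= w y x.
Proof. by apply: noise_weight_ge0; rewrite ltW//= -subr_ge0 ltW. Qed.

Let tail_le y : \sum_(x | (r < hdist x y)%N) w y x <= t.
Proof. by apply: noise_upper_tail => //; move: eta4; lra. Qed.

Let sum_split (F : cube n -> R) (y : cube n) :
  \sum_x F x = F y + \sum_(x in punctured_ball y r) F x
    + \sum_(x | (r < hdist x y)%N) F x.
Proof.
rewrite (bigID (fun x => (r < hdist x y)%N)) /= addrC; congr (_ + _).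
rewrite (bigD1 y) /= ?hdistxx//; congr (_ + _); apply: eq_bigl => x.
by rewrite inE -leqNgt.
Qed.

(** The tail and the centre contribute at most t + u; the second [u] makes the total strictly
    negative. *)
Let theta := t + 2 * u.

Let theta0 : 0 < theta.
Proof. by rewrite /theta ltr_pwDl ?expR_gt0// mulr_ge0// exprn_ge0// ltW. Qed.

(** Only the values of [f] in the ball of radius [r] around [y] enter, so centres more than [2 * r]
    apart give independent events. *)
Let opposed (y : cube n) (f : {ffun cube n -> bool}) :=
  spin R (f y) * signed_sum (w y) (enum (punctured_ball y r)) f <= - theta.

Lemma self_predicting_not_opposed (f : {ffun cube n -> bool}) (y : cube n) :
  self_predicting (1 - 2 * delta) f -> ~~ opposed y f.
Proof.
move=> /(self_predicting_agree y); apply: contraL; rewrite -ltNge /opposed.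
rewrite /signed_sum big_enum /= (sum_split _ y) noise_weightxx -/u !mulrDr.
under eq_bigr do rewrite mulrC.
rewrite mulrA -expr2 spin_sqr mul1r => hS.
have h : spin R (f y) * \sum_(x | (r < hdist x y)%N) spin R (f x) * w y x <= t.
  apply: le_trans (tail_le y); rewrite mulr_sumr; apply: ler_sum => x _.
  rewrite mulrA -[leRHS]mul1r ler_wpM2r//.
  by rewrite /spin; case: (f y); case: (f x); rewrite ?expr0 ?expr1; lra.
have u0 : 0 < u by rewrite exprn_gt0.
by move: hS h; rewrite /theta /w; lra.
Qed.

Hypothesis spread :
  36 * (t ^+ 2 + u ^+ 2) <= (delta ^+ 2 + (1 - delta) ^+ 2) ^+ n.

(** From the sum of all squared weights one removes u^2 for the centre and at most t^2 for the tail,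
    where each weight is bounded by the whole tail sum. *)
Lemma ball_variance (y : cube n) :
  4 * (t + 2 * u) ^+ 2 <= \sum_(x <- enum (punctured_ball y r)) w y x ^+ 2.
Proof.
rewrite big_enum /=.
have tail2 : \sum_(x | (r < hdist x y)%N) w y x ^+ 2 <= t ^+ 2.
  apply: (@le_trans _ _ (\sum_(x | (r < hdist x y)%N) t * w y x)).
    apply: ler_sum => x xr; rewrite expr2; apply: ler_wpM2r => //.
    apply: le_trans (tail_le y); rewrite (bigD1 x)//= lerDl.
    exact: sumr_ge0.
  by rewrite -mulr_sumr expr2 ler_wpM2l ?expR_ge0.
have := sum_noise_weight_sqr delta y.
rewrite (sum_split (fun x => noise_weight delta x y ^+ 2) y) noise_weightxx -/u.
move: tail2; rewrite /w; set a := \sum_(x | _) _; set b := \sum_(x in _) _.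
move=> tail2 E; move: spread; rewrite -E => {E} spr.
(* Here 4 (t + 2u)^2 <= 8 t^2 + 32 u^2; with the removed t^2 + u^2 this stays below 36 (t^2 +
   u^2). *)
have := sqr_ge0 (t - 2 * u); have := sqr_ge0 t; have := sqr_ge0 u; nra.
Qed.

Lemma sp_fraction_le_finite :
  sp_fraction n (1 - 2 * delta)
    <= expR (- (expR (n%:R * nat_divergence (2 * eta) 2^-1) / 10)).
Proof.
have ten1 : 10^-1 <= 1 :> R by lra.
have ten2 : 1 - 10^-1 <= expR (- 10^-1) :> R.
  by have := expR_ge1Dx (- 10^-1 : R); lra.
have r2 : (2 * r)%:R <= n%:R * (2 * eta).
  by rewrite natrM mulrCA ler_pM2l.
have eta0 : 0 < 2 * eta by rewrite mulr_gt0// (lt_trans delta0).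
(* The code needs relative distance [2 * eta] below 1/2, which is the origin of the threshold
   1/4. *)
have eta2 : 2 * eta < 2^-1 by move: eta4; lra.
have [C [Cdist Ccard]] := gilbert_varshamov eta0 eta2 r2.
pose B y := [set x : cube n | (hdist x y <= r)%N]%SET.
have N0 : 0 < #|{ffun cube n -> bool}|%:R :> R.
  by rewrite ltr0n; apply/card_gt0P; exists [ffun=> true].
have := @card_avoid_indep R (cube n) (cube n) B opposed 10^-1 (enum C)
  (enum_uniq _).
rewrite -cardE => avoid.
apply: (@le_trans _ _ ((1 - 10^-1) ^+ #|C|)).
  rewrite /sp_fraction ler_pdivrMr//.
  apply: le_trans (avoid _ _ _ _).
  - rewrite ler_nat; apply/subset_leq_card/fintype.subsetP => f; rewrite !inE => sp.
    by apply/allP => y _; exact: self_predicting_not_opposed.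
  - move=> x y; rewrite !mem_enum => xC yC xy z; rewrite !inE => zx.
    apply: contraTN (Cdist _ _ xC yC xy) => zy; rewrite -leqNgt mul2n -addnn.
    by rewrite (leq_trans (hdist_triangle z _ _))// leq_add// hdistC.
  - move=> y f g fg; rewrite /opposed fg ?inE ?hdistxx//; congr (_ * _ <= _).
    apply: eq_big_seq => x; rewrite mem_enum inE => /andP[xr _].
    by rewrite fg// inE.
  - exact: ten1.
  - move=> y _; apply: signed_sum_opposes => //; first exact: enum_uniq.
    + by rewrite mem_enum inE eqxx andbF.
    + exact: ball_variance.
apply: (@le_trans _ _ (expR (- (#|C|%:R / 10)))).
  rewrite -mulrN expRM_natl lerXn2r// nnegrE ?expR_ge0//.
  by rewrite subr_ge0.
by rewrite ler_expR lerN2 ler_pM2r// invr_gt0.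
Qed.

End finite_bound.

(** * Divergence and entropy: units, monotonicity, continuity *)

Lemma ln2_gt0 (R : realType) : 0 < ln 2 :> R.
Proof. by rewrite ln_gt0// ltr1n. Qed.

Lemma binary_divergenceE (R : realType) (p q : R) : 0 < p < 1 -> 0 < q < 1 ->
  binary_divergence p q = nat_divergence p q / ln 2.
Proof.
move=> /andP[p0 p1] /andP[q0 q1]; have := ln2_gt0 R => l2.
rewrite /binary_divergence /log2 /nat_divergence !ln_div ?posrE ?subr_gt0//.
by field; rewrite gt_eqF.
Qed.

Lemma nat_divergence_half (R : realType) (p : R) : 0 < p < 1 ->
  nat_divergence p 2^-1 = (1 - binary_entropy p) * ln 2.
Proof.
move=> /andP[p0 p1]; have := ln2_gt0 R => l2.
rewrite /binary_entropy /log2 /nat_divergence.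
rewrite (_ : 1 - 2^-1 = 2^-1 :> R); last by lra.
by rewrite lnV ?posrE//; field; rewrite gt_eqF.
Qed.

(** The inequality ln z <= z - 1 at z = y / x; added over the two outcomes it yields nonnegativity
    of the divergence. *)
Lemma ln_diff_ge (R : realType) (x y : R) : 0 < x -> 0 < y ->
  x - y <= x * (ln x - ln y).
Proof.
move=> x0 y0.
have : ln (y / x) <= y / x - 1.
  have -> : y / x = 1 + (y / x - 1) by ring.
  rewrite [leRHS](_ : _ = y / x - 1); last by ring.
  by apply: le_ln1Dx; rewrite ltrBrDl subrr divr_gt0.
rewrite ln_div ?posrE// => h.
have := ler_wpM2l (ltW x0) h.
have -> : x * (y / x - 1) = y - x by field; rewrite gt_eqF.
by lra.
Qed.

Lemma nat_divergence_ge0 (R : realType) (p q : R) : 0 < p < 1 -> 0 < q < 1 ->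
  0 <= nat_divergence p q.
Proof.
move=> p01 q01; rewrite /nat_divergence.
have h1 : p - q <= p * (ln p - ln q) by apply: ln_diff_ge; lra.
have h2 : (1 - p) - (1 - q) <= (1 - p) * (ln (1 - p) - ln (1 - q)).
  by apply: ln_diff_ge; lra.
by lra.
Qed.

(* Three-point identity: [D(p2||q) - D(p1||q)] is [D(p2||p1)] plus [p2 - p1]
   times a nonnegative log-likelihood ratio. *)
Lemma nat_divergence_mono (R : realType) (q p1 p2 : R) :
  0 < q -> q < p1 -> p1 <= p2 -> p2 < 1 ->
  nat_divergence p1 q <= nat_divergence p2 q.
Proof.
move=> q0 qp1 p12 p21.
have h : 0 <= nat_divergence p2 p1 by apply: nat_divergence_ge0; lra.
have l1 : ln q <= ln p1 by apply: ler_ln_pos; lra.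
have l2 : ln (1 - p1) <= ln (1 - q) by apply: ler_ln_pos; lra.
rewrite -subr_ge0.
have -> : nat_divergence p2 q - nat_divergence p1 q = nat_divergence p2 p1
   + (p2 - p1) * ((ln p1 - ln q) + (ln (1 - q) - ln (1 - p1))).
  by rewrite /nat_divergence; ring.
by rewrite addr_ge0// mulr_ge0; lra.
Qed.

(** Continuity in the first argument. It serves to show that the strict condition on eta is open,
    and later to let eta tend to [eta_min]. *)
Lemma nat_divergence_near (R : realType) (p q e : R) : 0 < p < 1 -> 0 < e ->
  exists2 d, 0 < d &
    forall x, `|p - x| < d -> `|nat_divergence p q - nat_divergence x q| < e.
Proof.
move=> /andP[p0 p1] e0.
have ct : nat_divergence x q @[x --> p] --> nat_divergence p q.
  have c1 : ln x @[x --> p] --> ln p by exact: continuous_ln.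
  have c2 : 1 - x @[x --> p] --> 1 - p by apply: cvgB; [exact: cvg_cst|exact: cvg_id].
  have c3 : ln (1 - x) @[x --> p] --> ln (1 - p).
    by apply: (cvg_comp _ _ c2); apply: continuous_ln; rewrite subr_gt0.
  apply: cvgD.
    by apply: cvgM; [exact: cvg_id|apply: cvgB; [exact: c1|exact: cvg_cst]].
  by apply: cvgM; [exact: c2|apply: cvgB; [exact: c3|exact: cvg_cst]].
have /cvgrPdist_lt/(_ e e0)/nbhs_ballP[d d0 hd] := ct.
by exists d => // x; apply: hd.
Qed.

(** * The infimum [eta_min] *)

(** The probability that two independent Bernoulli variables of parameter [delta] agree; its n-th
    power is the sum of the squared noise weights. *)
Definition collision (R : realType) (delta : R) : R :=
  delta ^+ 2 + (1 - delta) ^+ 2.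

Lemma collision_gt (R : realType) (delta : R) : 0 < delta ->
  (1 - delta) ^+ 2 < collision delta.
Proof. by move=> d0; rewrite /collision ltrDr exprn_gt0. Qed.

Lemma collision_gt0 (R : realType) (delta : R) : 0 < delta -> 0 < collision delta.
Proof. by move=> d0; apply: le_lt_trans (collision_gt d0); exact: sqr_ge0. Qed.

(** A consequence of (1 - delta)^2 < [collision delta]; it settles the first entry of the minimum in
    [eta_condition]. *)
Lemma collision_exponent_lt (R : realType) (delta : R) : 0 < delta < 1 ->
  2^-1 * log2 (collision delta)^-1 < log2 (1 - delta)^-1.
Proof.
move=> /andP[d0 d1]; have s0 := collision_gt0 d0.
rewrite /log2 mulrA ltr_pM2r ?invr_gt0 ?ln2_gt0// !lnV ?posrE ?subr_gt0//.
have : ln ((1 - delta) ^+ 2) < ln (collision delta).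
  by rewrite ltr_ln ?posrE ?exprn_gt0 ?subr_gt0// collision_gt.
by rewrite lnXn ?subr_gt0// mulr2n; lra.
Qed.

Lemma eta_conditionP (R : realType) (delta eta : R) :
  0 < delta < 1 -> 0 < eta < 1 ->
  eta_condition delta eta <-> - ln (collision delta) / 2 < nat_divergence eta delta.
Proof.
move=> d01 e01; rewrite /eta_condition -/(collision delta) lt_min.
rewrite (collision_exponent_lt d01) /= binary_divergenceE// /log2 mulrA.
rewrite ltr_pM2r ?invr_gt0 ?ln2_gt0// lnV ?posrE ?collision_gt0//; last by lra.
by rewrite mulrC.
Qed.

(** Makes the set defining [eta_min] nonempty, so that [inf] is a genuine infimum and not a default
    value. *)
Lemma eta_condition1 (R : realType) (delta : R) : 0 < delta < 1 ->
  eta_condition delta 1.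
Proof.
move=> d01; have d0 : 0 < delta by lra.
rewrite /eta_condition -/(collision delta) lt_min (collision_exponent_lt d01) /=.
rewrite /binary_divergence subrr mul0r addr0 mul1r div1r.
rewrite /log2 mulrA ltr_pM2r ?invr_gt0 ?ln2_gt0// !lnV ?posrE ?collision_gt0//.
have : ln (delta ^+ 2) < ln (collision delta).
  rewrite ltr_ln ?posrE ?exprn_gt0 ?collision_gt0// /collision ltrDl exprn_gt0//.
  by lra.
by rewrite lnXn// mulr2n; lra.
Qed.

Lemma has_inf_eta (R : realType) (delta : R) : 0 < delta < 1 ->
  has_inf [set eta : R | delta < eta <= 1 /\ eta_condition delta eta].
Proof.
move=> d01; split.
  by exists 1; split; [case/andP: d01 => _ ->; rewrite lexx|exact: eta_condition1].
by exists delta => eta [/andP[/ltW]].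
Qed.

Lemma eta_min_ge (R : realType) (delta : R) : 0 < delta < 1 ->
  delta <= eta_min delta.
Proof.
move=> d01; apply: lb_le_inf; first by case: (has_inf_eta d01).
by move=> eta [/andP[/ltW]].
Qed.

(** Some admissible [e] lies below [eta], and monotonicity of the divergence carries its inequality
    up to [eta]. *)
Lemma eta_min_lt_divergence (R : realType) (delta eta : R) :
  0 < delta < 1 -> eta_min delta < eta -> eta < 1 ->
  - ln (collision delta) / 2 < nat_divergence eta delta.
Proof.
move=> d01 me e1.
have me0 : 0 < eta - eta_min delta by rewrite subr_gt0.
have [e [/andP[de _] ce] ee] := inf_adherent me0 (has_inf_eta d01).
rewrite -/(eta_min delta) addrC subrK in ee.
have : - ln (collision delta) / 2 < nat_divergence e delta.
  by apply/eta_conditionP => //; lra.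
by move=> /lt_le_trans; apply; apply: nat_divergence_mono; lra.
Qed.

(** The strict inequality is an open condition, so a point slightly below [eta], still above
    [delta], is admissible. *)
Lemma divergence_eta_min_lt (R : realType) (delta eta : R) :
  0 < delta -> delta < eta -> eta < 1 ->
  - ln (collision delta) / 2 < nat_divergence eta delta ->
  eta_min delta < eta.
Proof.
move=> d0 de e1 ce.
have [||d dgt0 hd] := @nat_divergence_near R eta delta
  (nat_divergence eta delta - - ln (collision delta) / 2); [lra|lra|].
pose g := Num.min d (eta - delta).
have g0 : 0 < g by rewrite lt_min dgt0; lra.
have gd : g <= d by rewrite ge_min lexx.
have ge : g <= eta - delta by rewrite ge_min lexx orbT.
have gn : `|eta - (eta - g / 2)| < d.
  rewrite (_ : eta - (eta - g / 2) = g / 2); last by ring.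
  by rewrite gtr0_norm; lra.
have h := le_lt_trans (ler_norm _) (hd _ gn).
apply: (@le_lt_trans _ _ (eta - g / 2)); last by lra.
apply: ge_inf; first by case: (@has_inf_eta R delta) => //; lra.
by split; [lra|apply/eta_conditionP; lra].
Qed.

(** * Numerical location of [delta_max] *)

Lemma quarter_conditionP (R : realType) (delta : R) : 0 < delta < 1 ->
  (- ln (collision delta) / 2 < nat_divergence 4^-1 delta) =
  (256 * (delta * (1 - delta) ^+ 3) < 27 * collision delta ^+ 2).
Proof.
move=> /andP[d0 d1]; have s0 := collision_gt0 d0.
have d10 : 0 < 1 - delta by lra.
have h0 : 0 < delta * (1 - delta) ^+ 3 by rewrite mulr_gt0// exprn_gt0.
rewrite -(@ltr_ln R (256 * _)) ?posrE ?mulr_gt0 ?exprn_gt0//.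
have -> : ln (256 * (delta * (1 - delta) ^+ 3))
    = ln 256 + (ln delta + 3 * ln (1 - delta)).
  by rewrite lnM ?posrE// lnM ?posrE ?exprn_gt0// lnXn// mulr_natl.
have -> : ln (27 * collision delta ^+ 2) = ln 27 + 2 * ln (collision delta).
  by rewrite lnM ?posrE ?exprn_gt0// lnXn// mulr_natl.
(* Four times the divergence at 1/4 equals ln 27 - ln 256 - ln (delta (1 - delta)^3). *)
rewrite /nat_divergence.
rewrite (_ : 1 - 4^-1 = 3 / 4 :> R); last by lra.
have -> : ln 256 = 4 * ln 4 :> R.
  by rewrite (_ : 256 = 4 ^+ 4 :> R) ?lnXn ?mulr_natl//; ring.
have -> : ln 27 = 3 * ln 3 :> R.
  by rewrite (_ : 27 = 3 ^+ 3 :> R) ?lnXn ?mulr_natl//; ring.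
rewrite ln_div ?posrE// lnV ?posrE//.
by apply/idP/idP => ?; lra.
Qed.

Lemma quarter_condition_below (R : realType) (delta : R) :
  0 < delta <= 974 / 10 ^+ 4 ->
  256 * (delta * (1 - delta) ^+ 3) < 27 * collision delta ^+ 2.
Proof. by rewrite /collision => /andP[d0 d1]; nra. Qed.

(** Together with the previous bound this brackets the crossing between 0.0974 and 0.09744. *)
Lemma quarter_condition_fails (R : realType) (delta : R) :
  delta = 9744 / 10 ^+ 5 ->
  27 * collision delta ^+ 2 <= 256 * (delta * (1 - delta) ^+ 3).
Proof. by move=> ->; rewrite /collision; lra. Qed.

Definition quarter_set (R : realType) : set R :=
  [set d : R | 0 < d <= 2^-1 /\
     forall delta : R, 0 < delta < d -> eta_min delta < 4^-1].
Arguments quarter_set : clear implicits.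

Lemma quarter_set_mem (R : realType) : quarter_set R (974 / 10 ^+ 4).
Proof.
split=> [|delta d01]; first by lra.
apply: divergence_eta_min_lt; [lra|lra|lra|].
rewrite quarter_conditionP; last by lra.
by apply: quarter_condition_below; lra.
Qed.

Lemma quarter_set_ubound (R : realType) : ubound (quarter_set R) (9744 / 10 ^+ 5).
Proof.
move=> d [_ dE]; rewrite leNgt; apply/negP => dgt.
have : - ln (collision (9744 / 10 ^+ 5 : R)) / 2
    < nat_divergence 4^-1 (9744 / 10 ^+ 5).
  by apply: eta_min_lt_divergence; [lra|apply: dE; lra|lra].
rewrite quarter_conditionP; last by lra.
by rewrite ltNge quarter_condition_fails.
Qed.

Lemma delta_max_bounds (R : realType) :
  974 / 10 ^+ 4 <= delta_max R <= 9744 / 10 ^+ 5.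
Proof.
apply/andP; split.
  apply: ub_le_sup (quarter_set_mem R).
  by exists (9744 / 10 ^+ 5); exact: quarter_set_ubound.
by apply: ge_sup (@quarter_set_ubound R); exists (974 / 10 ^+ 4); exact: quarter_set_mem.
Qed.

Lemma eta_min_lt_quarter (R : realType) (delta : R) :
  0 < delta < delta_max R -> eta_min delta < 4^-1.
Proof.
move=> /andP[d0 dm].
have hs : has_sup (quarter_set R).
  by split; [exists (974 / 10 ^+ 4); exact: quarter_set_mem
            |exists (9744 / 10 ^+ 5); exact: quarter_set_ubound].
have gap : 0 < delta_max R - delta by rewrite subr_gt0.
have [e [_ he] de] := sup_adherent gap hs.
by apply: he; rewrite d0 /=; move: de; rewrite -/(delta_max R) subKr.
Qed.

(** * Asymptotics in the block length *)

Lemma near_geometric_le (R : realType) (a e : R) : 0 <= a < 1 -> 0 < e ->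
  \forall n \near \oo, a ^+ n <= e.
Proof.
move=> /andP[a0 a1] e0.
have /cvgrPdist_le/(_ e e0) : a ^+ n @[n --> \oo] --> 0.
  by apply: cvg_expr; rewrite ger0_norm.
by apply: filterS => n; rewrite sub0r normrN ger0_norm// exprn_ge0.
Qed.

(** Relative to [collision delta ^+ n], the squares t^2 and u^2 are the powers [a ^+ n] and [b ^+ n]
    with [a] and [b] below 1, so the spread hypothesis holds for all large n. *)
Lemma near_sp_fraction_le (R : realType) (delta eta : R) :
  0 < delta -> delta < eta -> eta < 4^-1 ->
  - ln (collision delta) / 2 < nat_divergence eta delta ->
  \forall n \near \oo, sp_fraction n (1 - 2 * delta)
    <= expR (- (expR (n%:R * nat_divergence (2 * eta) 2^-1) / 10)).
Proof.
move=> d0 de e4 ce; have s0 := collision_gt0 d0.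
pose a := expR (- (2 * nat_divergence eta delta)) / collision delta.
pose b := (1 - delta) ^+ 2 / collision delta.
have a01 : 0 <= a < 1.
  rewrite divr_ge0 ?expR_ge0 ?(ltW s0)//= ltr_pdivrMr// mul1r.
  by rewrite -[ltRHS]lnK ?posrE// ltr_expR; lra.
have b01 : 0 <= b < 1.
  by rewrite divr_ge0 ?sqr_ge0 ?(ltW s0)//= ltr_pdivrMr// mul1r collision_gt.
(* Since 72 = 2 * 36, each of the two terms takes half of the allowance. *)
have e72 : 0 < 72^-1 :> R by rewrite invr_gt0.
near=> n.
have an : a ^+ n <= 72^-1 by near: n; exact: near_geometric_le.
have bn : b ^+ n <= 72^-1 by near: n; exact: near_geometric_le.
have ne0 : 0 <= n%:R * eta by rewrite mulr_ge0//; lra.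
have /andP[rl ru] := truncn_itv ne0.
apply: (@sp_fraction_le_finite R n (Num.truncn (n%:R * eta))) => //; first exact: ltW.
have sn : 0 < collision delta ^+ n by rewrite exprn_gt0.
rewrite -/(collision delta).
have -> : expR (- (n%:R * nat_divergence eta delta)) ^+ 2
    = a ^+ n * collision delta ^+ n.
  rewrite -exprMn divfK ?gt_eqF// -!expRM_natl; congr expR; ring.
have -> : ((1 - delta) ^+ n) ^+ 2 = b ^+ n * collision delta ^+ n.
  by rewrite -exprMn divfK ?gt_eqF// -!exprM mulnC.
rewrite -mulrDl mulrA -[leRHS]mul1r ler_pM2r//.
move: an bn; set x := a ^+ n; set y := b ^+ n; lra.
Unshelve. all: by end_near.
Qed.

(* The witness [r n] is the least nonnegative remainder for which the bound holds
   at [n]. *)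
Lemma exists_remainder (R : realType) (a : nat -> R) (c : R) :
  (forall n, 0 <= a n) ->
  (forall e, 0 < e -> \forall n \near \oo,
     a n <= expR (- 2 `^ (n%:R * c - e * n%:R))) ->
  exists r : nat -> R, (r n / n%:R @[n --> \oo] --> (0 : R)) /\
    \forall n \near \oo, a n <= expR (- 2 `^ (n%:R * c - r n)).
Proof.
move=> a0 ha; have l2 := ln2_gt0 R.
have pow2 x : 2 `^ x = expR (x * ln 2) :> R by rewrite /powR pnatr_eq0.
(* When [a n] is zero every remainder works, and 0 is taken; otherwise the double exponential is
   inverted. *)
pose r n := if a n == 0 then 0
            else Num.max 0 (n%:R * c - ln (- ln (a n)) / ln 2).
have lnln n e : 0 < a n -> a n <= expR (- 2 `^ (n%:R * c - e)) ->
    0 < - ln (a n) /\ n%:R * c - ln (- ln (a n)) / ln 2 <= e.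
  move=> an0 h.
  have hL : 2 `^ (n%:R * c - e) <= - ln (a n).
    by rewrite lerNr -ler_expR lnK ?posrE.
  have L0 : 0 < - ln (a n) by apply: lt_le_trans hL; exact: powR_gt0.
  split=> //; rewrite lerBlDr -lerBlDl ler_pdivlMr//.
  by rewrite -ler_expR lnK ?posrE// -pow2.
exists r; split.
  apply/cvgrPdist_le => e e0; near=> n.
  have n0 : 0 < n%:R :> R by rewrite ltr0n; near: n; exact: nbhs_infty_gt.
  have rn0 : 0 <= r n by rewrite /r; case: ifP => // _; rewrite le_max lexx.
  rewrite sub0r normrN ger0_norm ?divr_ge0 ?(ltW n0)// ler_pdivrMr// /r.
  case: ifPn => [_|an]; first by rewrite mulr_ge0 ?ltW.
  rewrite ge_max mulr_ge0 ?(ltW e0) ?(ltW n0)//=.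
  have an0 : 0 < a n by rewrite lt_neqAle eq_sym an a0.
  suff /(lnln _ _ an0)[] : a n <= expR (- 2 `^ (n%:R * c - e * n%:R)) by [].
  by near: n; exact: ha.
near=> n; rewrite /r; case: ifPn => [/eqP ->|an]; first exact: expR_ge0.
have an0 : 0 < a n by rewrite lt_neqAle eq_sym an a0.
(* The hypothesis at e = 1 gives [- ln (a n) > 0], under which the outer logarithm can be
   inverted. *)
have [L0 _] : 0 < - ln (a n) /\
    n%:R * c - ln (- ln (a n)) / ln 2 <= 1 * n%:R.
  by apply: lnln => //; near: n; exact: ha.
set m := Num.max _ _.
have mL : n%:R * c - ln (- ln (a n)) / ln 2 <= m by rewrite le_max lexx orbT.
rewrite -[leLHS]lnK ?posrE// ler_expR lerNr pow2 -[leRHS]lnK ?posrE//.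
by rewrite ler_expR -ler_pdivlMr//; lra.
Unshelve. all: by end_near.
Qed.

(** Half of [e] pays for moving from [eta_min] to a slightly larger eta, the other half absorbs the
    factor 1/10. *)
Lemma near_sp_fraction_exponent (R : realType) (delta e : R) :
  0 < delta < delta_max R -> 0 < e ->
  \forall n \near \oo, sp_fraction n (1 - 2 * delta) <=
    expR (- 2 `^ (n%:R * (1 - binary_entropy (2 * eta_min delta)) - e * n%:R)).
Proof.
move=> dm e0; have m4 := eta_min_lt_quarter dm; have l2 := ln2_gt0 R.
have [d0 d1] : 0 < delta /\ delta < 1.
  by have := delta_max_bounds R; move: dm; lra.
have dE : delta <= eta_min delta by apply: eta_min_ge; rewrite d0.
set m := eta_min delta in m4 dE *.
have el0 : 0 < e * ln 2 by rewrite mulr_gt0.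
have [||g g0 hg] := @nat_divergence_near R (2 * m) 2^-1 (e * ln 2 / 2); [lra|lra|].
pose k := Num.min g (4^-1 - m).
have k0 : 0 < k by rewrite lt_min g0; lra.
have kg : k <= g by rewrite ge_min lexx.
have km : k <= 4^-1 - m by rewrite ge_min lexx orbT.
(* Then 2 eta - 2 m = k / 2 is below the continuity radius [g], and eta remains below 1/4. *)
pose eta := m + k / 4.
have ng : `|2 * m - 2 * eta| < g.
  rewrite (_ : 2 * m - 2 * eta = - (k / 2)); last by rewrite /eta; field.
  by rewrite normrN gtr0_norm; lra.
have h := le_lt_trans (ler_norm _) (hg _ ng).
have me : m < eta by rewrite /eta; lra.
have e4 : eta < 4^-1 by rewrite /eta; lra.
have ce : - ln (collision delta) / 2 < nat_divergence eta delta.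
  by apply: eta_min_lt_divergence; [lra|exact: me|lra].
have a01 : 0 <= expR (- (e * ln 2 / 2)) < 1.
  by rewrite expR_ge0 expR_lt1; lra.
have ten : 0 < 10^-1 :> R by lra.
rewrite nat_divergence_half in h; last by lra.
near=> n.
have an : expR (- (e * ln 2 / 2)) ^+ n <= 10^-1 by near: n; exact: near_geometric_le.
apply: (@le_trans _ _ (expR (- (expR (n%:R * nat_divergence (2 * eta) 2^-1) / 10)))).
  by near: n; apply: near_sp_fraction_le; lra.
rewrite ler_expR lerN2 /powR pnatr_eq0 /=.
apply: le_trans (ler_wpM2l (expR_ge0 _) an).
rewrite -expRM_natl -expRD ler_expR.
have := ler_wpM2l (ler0n R n) (ltW h).
set D := nat_divergence _ _; set H := binary_entropy _; lra.
Unshelve. all: by end_near.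
Qed.

Lemma sp_fraction_ge0 (R : realType) (n : nat) (rho : R) : 0 <= sp_fraction n rho.
Proof. by rewrite divr_ge0. Qed.

Theorem theorem7p2 (R : realType) :
  `|delta_max R - 974 / 10 ^+ 4| < 5 / 10 ^+ 5 /\
  forall delta : R, 0 < delta < delta_max R ->
    exists r : nat -> R,
      (r n / n%:R @[n --> \oo] --> (0 : R)) /\
      \forall n \near \oo,
        sp_fraction n (1 - 2 * delta) <=
        expR (- 2 `^ (n%:R * (1 - binary_entropy (2 * eta_min delta)) - r n)).
Proof.
split; first by have := delta_max_bounds R; rewrite ltr_norml; lra.
move=> delta dm; apply: exists_remainder => [n|e e0].
  exact: sp_fraction_ge0.
exact: near_sp_fraction_exponent.
Qed.
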